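(* Let $f,g:\mathbb{C}^n\to\mathbb{C}$ be two polynomials. If $f$ and $g$ are bi-Lipschitz right-left equivalent at infinity, then $\deg(f)=\deg(g)$.
   Context: $\deg$ denotes the degree of a polynomial. A bi-Lipschitz homeomorphism is a bijection that is Lipschitz with Lipschitz inverse (for the distance induced by the Euclidean norm). Two polynomials $f,g:\mathbb{C}^n\to\mathbb{C}$ are bi-Lipschitz right-left equivalent at infinity if there are compact subsets $K,\widetilde K\subset\mathbb{C}^n$ and bi-Lipschitz homeomorphisms $\varphi:\mathbb{C}^n\setminus K\to\mathbb{C}^n\setminus\widetilde K$ and $\phi:\mathbb{C}\to\mathbb{C}$ such that $f(x)=\phi\circ g\circ\varphi(x)$ for all $x\in\mathbb{C}^n\setminus K$. *)

(* Defs.v *)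
From mathcomp Require Import all_boot all_order all_algebra.
From mathcomp Require Import all_classical all_reals all_analysis.
From mathcomp Require Import complex.
(* The notations of mpoly clash with those of the analysis library. *)
From mathcomp Require mpoly.
Import -(notations) mpoly.
Import Order.TTheory GRing.Theory Num.Theory.
Import numFieldNormedType.Exports.

Set Implicit Arguments.
Unset Strict Implicit.
Unset Printing Implicit Defensive.

Local Open Scope classical_set_scope.
Local Open Scope ring_scope.
Local Open Scope complex_scope.

(* R[i] itself carries no topology in the library; packed as a numFieldType it
   has the one given by the modulus, and 'rV[C R]_n has the product topology,
   so that compactness in C^n is the library's [compact]. *)
Definition C (R : realType) : numFieldType := R[i].

Definition cmod (R : realType) (z : C R) : R := ComplexField.Normc.normc z.

Definition cdist (R : realType) (z w : C R) : R := cmod (z - w).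

(* The library norm on 'rV[C R]_n is the maximum norm, hence this definition
   of the Euclidean norm. *)
Definition enorm (R : realType) (n : nat) (x : 'rV[C R]_n) : R :=
  Num.sqrt (\sum_(i < n) cmod (x ord0 i) ^+ 2).

Definition edist (R : realType) (n : nat) (x y : 'rV[C R]_n) : R :=
  enorm (x - y).

Definition lipschitz_wrt (R : realType) (T U : Type) (dT : T -> T -> R)
    (dU : U -> U -> R) (A : set T) (f : T -> U) : Prop :=
  exists L : R, forall x y, A x -> A y -> dU (f x) (f y) <= L * dT x y.

(* Only the values of h on A matter; k is the inverse B -> A of h, extended
   arbitrarily outside B. *)
Definition bilipschitz_homeo (R : realType) (T U : Type) (dT : T -> T -> R)
    (dU : U -> U -> R) (A : set T) (B : set U) (h : T -> U) : Prop :=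
  [/\ set_bij A B h,
      lipschitz_wrt dT dU A h &
      exists k : U -> T,
        (forall x, A x -> k (h x) = x) /\ lipschitz_wrt dU dT B k].

Definition poly_fun (R : realType) (n : nat) (p : mpoly.mpoly n (C R))
    (x : 'rV[C R]_n) : C R :=
  mpoly.meval (x ord0) p.

(* msize is the total degree plus one, and 0 for the zero polynomial, which
   thus gets degree 0 here, like the other constants. *)
Definition poly_deg (R : realType) (n : nat) (p : mpoly.mpoly n (C R)) : nat :=
  (mpoly.msize p).-1.

Definition bilipschitz_RL_equiv_at_infinity (R : realType) (n : nat)
    (f g : 'rV[C R]_n -> C R) : Prop :=
  exists (K K' : set 'rV[C R]_n) (phi : 'rV[C R]_n -> 'rV[C R]_n)
         (psi : C R -> C R),
    [/\ compact K,
        compact K',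
        bilipschitz_homeo (@edist R n) (@edist R n) (~` K) (~` K') phi,
        bilipschitz_homeo (@cdist R) (@cdist R) setT setT psi &
        forall x, (~` K) x -> f x = psi (g (phi x))].

(* Main.v *)
(* Lipschitz maps grow at most linearly, so f = psi o g o phi outside a compact
   set gives |f x| <= c (1 + |x|) ^ deg g there. Along the ray t v, with v a
   point where the leading form of f does not vanish, |f (t v)| grows like
   t ^ deg f, hence deg f <= deg g. The inverses of phi and psi give the
   reverse inequality. *)
From mathcomp Require Import all_boot all_order all_algebra.
From mathcomp Require Import all_classical all_reals all_analysis.
From mathcomp Require Import complex lra.
From mathcomp Require mpoly.
(* Required last, since the analysis library also has an [edist]. *)
Require Import Defs.
Import -(notations) mpoly.
Import Order.TTheory GRing.Theory Num.Theory.
Import numFieldNormedType.Exports.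

Set Implicit Arguments.
Unset Strict Implicit.
Unset Printing Implicit Defensive.

Local Open Scope classical_set_scope.
Local Open Scope ring_scope.
Local Open Scope complex_scope.

(** * Points where a nonzero polynomial or its leading form does not vanish *)

(** Reduction modulo [N] isolates the digit of index 0; cancelling it and dividing by [N] leaves the
    induction hypothesis. This keeps monomials apart under Kronecker substitution. *)
Lemma sum_base_inj (n N : nat) (a b : 'I_n -> nat) :
  (forall i, a i < N)%N -> (forall i, b i < N)%N ->
  (\sum_i a i * N ^ i = \sum_i b i * N ^ i)%N -> a =1 b.
Proof.
elim: n a b => [|n IHn] a b aN bN; first by move=> _ [].
have shift (c : 'I_n.+1 -> nat) :
    (\sum_i c i * N ^ i =
     (\sum_(i < n) c (lift ord0 i) * N ^ i) * N + c ord0)%N.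
  rewrite big_ord_recl expn0 muln1 addnC big_distrl /=; congr addn.
  by apply: eq_bigr => i _; rewrite expnSr mulnA.
rewrite !shift => e.
have N0 : (0 < N)%N by apply: leq_ltn_trans (aN ord0).
have e0 : a ord0 = b ord0.
  by move: (congr1 (modn^~ N) e); rewrite !modnMDl !modn_small.
have eS := IHn (fun i => a (lift ord0 i)) (fun i => b (lift ord0 i))
  (fun i => aN _) (fun i => bN _).
move: e; rewrite e0 => /addIn/eqP; rewrite eqn_pmul2r// => /eqP/eS eqS i.
by have [j ->|->] := unliftP ord0 i; [exact: eqS|].
Qed.

(** In characteristic zero the integers from 0 to [size q - 1] are distinct, and they are too many
    to be all roots of [q]. *)
Lemma poly_nonroot (K : numDomainType) (q : {poly K}) :
  q != 0 -> exists s, q.[s] != 0.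
Proof.
move=> q0; apply/not_existsP => rootq.
pose rs := [seq i%:R : K | i <- iota 0 (size q)].
have : (size rs < size q)%N.
  apply: max_poly_roots => //.
    by apply/allP => s _; apply/negPn/negP => /rootq.
  rewrite map_inj_uniq ?iota_uniq// => i j /eqP.
  by rewrite eqr_nat => /eqP.
by rewrite size_map size_iota ltnn.
Qed.

(* Kronecker substitution: v i = s ^ (N ^ i) with N larger than all the
   exponents separates the monomials of p. *)
Lemma mpoly_nonroot (K : numDomainType) (n : nat) (p : mpoly n K) :
  p != 0 -> exists v, meval v p != 0.
Proof.
move=> p0; pose N := msize p.
pose k (m : multinom n) := (\sum_(i < n) m i * N ^ i)%N.
have ltN (m : multinom n) i : m \in msupp p -> (m i < N)%N.
  move=> /msize_mdeg_lt; apply: leq_ltn_trans.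
  by rewrite mdegE (bigD1 i)//= leq_addr.
pose q : {poly K} := \sum_(m <- msupp p) mcoeff m p *: 'X^(k m).
have leadP := mlead_supp p0.
have q0 : q != 0.
  (* The exponent [k (mlead p)] comes from [mlead p] alone, so its coefficient in [q] is the leading
     coefficient of [p]. *)
  apply/negP => /eqP/(congr1 (fun q : {poly K} => q`_(k (mlead p)))).
  rewrite coef0 coef_sum (bigD1_seq (mlead p))//=.
  rewrite coefZ coefXn eqxx mulr1 big_seq_cond big1 ?addr0.
    by move/eqP; rewrite mcoeff_eq0 leadP.
  move=> m /andP[mp mlead_m]; rewrite coefZ coefXn; case: eqP => [e|].
    case/eqP: mlead_m; apply/mnmP => i.
    by apply: (@sum_base_inj n N m (mlead p)) => // j; exact: ltN.
  by rewrite mulr0.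
have [s qs] := poly_nonroot q0.
exists (fun i => s ^+ (N ^ i)); apply: contraNneq qs => ps.
rewrite -[X in _ == X]ps mevalE horner_sum; apply/eqP/eq_bigr => m _.
rewrite hornerZ hornerXn /k -prodrXr; congr (_ * _).
by apply: eq_bigr => i _; rewrite -exprM mulnC.
Qed.

(** The coefficient of [mlead p] survives, since this monomial has degree [(msize p).-1]. *)
Lemma pihomog_lead_neq0 (K : nzRingType) (n : nat) (p : mpoly n K) :
  p != 0 -> pihomog mdeg (msize p).-1 p != 0.
Proof.
move=> p0; have leadP := mlead_supp p0.
apply/negP => /eqP/(congr1 (mcoeff (mlead p))).
rewrite mcoeff0 pihomogE raddf_sum /= -big_filter.
rewrite (bigD1_seq (mlead p)) ?filter_uniq//=; last first.
  by rewrite mem_filter leadP -(mlead_deg p0) eqxx.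
rewrite mcoeffZ mcoeffX eqxx mulr1 big1 ?addr0.
  by move/eqP; rewrite mcoeff_eq0 leadP.
by move=> m /negPf e; rewrite mcoeffZ mcoeffX e mulr0.
Qed.

(** * The complex modulus *)

Section Modulus.
Variable R : realType.
Implicit Types z w : C R.

Lemma cmod_ge0 z : 0 <= cmod z.
Proof. by case: z => a b; exact: sqrtr_ge0. Qed.

Lemma cmod0 : cmod (0 : C R) = 0.
Proof. exact: ComplexField.Normc.normc0. Qed.

Lemma cmod1 : cmod (1 : C R) = 1.
Proof. exact: ComplexField.Normc.normc1. Qed.

Lemma cmodM z w : cmod (z * w) = cmod z * cmod w.
Proof. exact: ComplexField.Normc.normcM. Qed.

Lemma cmodX z k : cmod (z ^+ k) = cmod z ^+ k.
Proof. by elim: k => [|k IH]; rewrite ?expr0 ?cmod1// !exprS cmodM IH. Qed.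

Lemma cmodD z w : cmod (z + w) <= cmod z + cmod w.
Proof. exact: le_normcD. Qed.

Lemma cmodN z : cmod (- z) = cmod z.
Proof. exact: normcN. Qed.

Lemma cmodBC z w : cmod (z - w) = cmod (w - z).
Proof. by rewrite -cmodN opprB. Qed.

Lemma cmod_le_addB z w : cmod z <= cmod w + cmod (z - w).
Proof. by rewrite -[in leLHS](subrKC w z) cmodD. Qed.

Lemma cmod_gt0 z : (0 < cmod z) = (z != 0).
Proof.
have [->|z0] := eqVneq z 0; first by rewrite cmod0 ltxx.
rewrite lt_def cmod_ge0 andbT; apply: contraNneq z0.
by move=> /ComplexField.Normc.eq0_normc ->.
Qed.

Lemma cmod_real (t : R) : 0 <= t -> cmod (t%:C : C R) = t.
Proof. by move=> t0; rewrite /cmod /= expr0n addr0 sqrtr_sqr ger0_norm. Qed.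

Lemma cmod_sum (I : Type) (r : seq I) (P : pred I) (F : I -> C R) :
  cmod (\sum_(i <- r | P i) F i) <= \sum_(i <- r | P i) cmod (F i).
Proof.
elim/big_rec2: _ => [|i x y _ le_yx]; first by rewrite cmod0.
by apply: le_trans (cmodD _ _) _; rewrite lerD2l.
Qed.

Lemma cmod_prod (I : Type) (r : seq I) (P : pred I) (F : I -> C R) :
  cmod (\prod_(i <- r | P i) F i) = \prod_(i <- r | P i) cmod (F i).
Proof. exact: (big_morph _ cmodM cmod1). Qed.

End Modulus.

(** * Comparison of norms and boundedness of compact sets *)

(** Equivalent to [enorm], so growth orders are the same, but free of square roots and summable
    coordinate by coordinate. *)
Definition l1norm (R : realType) (n : nat) (x : 'rV[C R]_n) : R :=
  \sum_(i < n) cmod (x ord0 i).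

Section Norms.
Variables (R : realType) (n : nat).
Implicit Types x y : 'rV[C R]_n.

Lemma l1norm_ge0 x : 0 <= l1norm x.
Proof. by apply: sumr_ge0 => i _; exact: cmod_ge0. Qed.

Lemma cmod_le_l1norm x i : cmod (x ord0 i) <= l1norm x.
Proof.
by rewrite /l1norm (bigD1 i)//= lerDl sumr_ge0// => j _; exact: cmod_ge0.
Qed.

Lemma cmod_le_enorm x i : cmod (x ord0 i) <= enorm x.
Proof.
rewrite -[leLHS]ger0_norm ?cmod_ge0// -sqrtr_sqr ler_sqrt; last first.
  by apply: sumr_ge0 => j _; exact: sqr_ge0.
by rewrite (bigD1 i)//= lerDl sumr_ge0// => j _; exact: sqr_ge0.
Qed.

Lemma enorm_le_l1norm x : enorm x <= l1norm x.
Proof.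
rewrite -[leRHS]ger0_norm ?l1norm_ge0// -sqrtr_sqr ler_sqrt ?sqr_ge0//.
rewrite expr2 [X in X * _]/l1norm big_distrl /=; apply: ler_sum => i _.
by rewrite expr2 ler_wpM2l ?cmod_ge0// cmod_le_l1norm.
Qed.

Lemma l1normZ (t : R) x : 0 <= t -> l1norm ((t%:C : C R) *: x) = t * l1norm x.
Proof.
move=> t0; rewrite /l1norm big_distrr /=; apply: eq_bigr => i _.
by rewrite mxE cmodM cmod_real.
Qed.

Lemma edist_le_l1norm x y : edist x y <= l1norm x + l1norm y.
Proof.
apply: le_trans (enorm_le_l1norm _) _; rewrite -big_split /=.
apply: ler_sum => i _; rewrite !mxE.
by apply: le_trans (cmodD _ _) _; rewrite cmodN.
Qed.

(** Each coordinate of [x - y] has modulus at most [edist x y]; summing over the coordinates gives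
    the factor [n]. *)
Lemma l1norm_le_edist x y : l1norm x <= l1norm y + n%:R * edist x y.
Proof.
have -> : n%:R * edist x y = \sum_(i < n) edist x y.
  by rewrite sumr_const card_ord mulr_natl.
rewrite -big_split /=; apply: ler_sum => i _.
apply: le_trans (cmod_le_addB _ (y ord0 i)) _; rewrite lerD2l.
by have := cmod_le_enorm (x - y) i; rewrite !mxE.
Qed.

(** Near each point the norm is at most [N] for all large [N]; the near-covering form of compactness
    yields one [N] for all of [K]. *)
Lemma compact_l1norm_bounded (K : set 'rV[C R]_n) :
  compact K -> exists M : R, forall x, K x -> l1norm x <= M.
Proof.
move=> /compact_near_coveringP/(_ nat \oo (fun N x => l1norm x <= N%:R) _).
case=> [x _|N _ KN]; last first.
  by exists N%:R; exact: (KN N (leqnn N)).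
have ball1 : nbhs x (ball x 1) by exact: nbhsx_ballx.
(* On the unit ball of the maximum norm each coordinate moves by less than 1, which adds at most [n]
   to [l1norm]. *)
have large : \forall N \near \oo, l1norm x + n%:R <= N%:R.
  exists (Num.truncn (l1norm x + n%:R)).+1 => // N /= leN.
  apply: ltW; apply: lt_le_trans (truncnS_gt _) _.
  by rewrite ler_nat.
exists (ball x 1, [set N | l1norm x + n%:R <= N%:R]) => //=.
move=> [y N] /= [[_ xy] le_N]; apply: le_trans le_N.
have -> : n%:R = \sum_(i < n) (1 : R) by rewrite sumr_const card_ord.
rewrite -big_split /=; apply: ler_sum => i _.
apply: le_trans (cmod_le_addB _ (x ord0 i)) _; rewrite lerD2l cmodBC.
have := xy ord0 i; rewrite -ball_normE /=.
by move=> /ltW; rewrite normc_def lecR /cmod; case: (_ - _).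
Qed.

End Norms.

(** * Growth of polynomials and of Lipschitz maps *)

Section Growth.
Variables (R : realType) (n : nat).
Implicit Types p : mpoly n (C R).

Lemma cmod_monomial_le (m : multinom n) (x : 'rV[C R]_n) (r : R) :
  l1norm x <= r -> cmod (\prod_i x ord0 i ^+ m i) <= r ^+ mdeg m.
Proof.
move=> xr; rewrite cmod_prod mdegE -prodrXr; apply: ler_prod => i _.
rewrite cmodX exprn_ge0 ?cmod_ge0//= lerXn2r ?nnegrE ?cmod_ge0//.
  exact: le_trans (l1norm_ge0 x) xr.
exact: le_trans (cmod_le_l1norm _ _) xr.
Qed.

(** As [1 + l1norm x] is at least 1, its power of exponent [poly_deg p] dominates every monomial of
    [p]. *)
Lemma poly_fun_growth p : exists2 c : R, 0 <= c &
  forall x, cmod (poly_fun p x) <= c * (1 + l1norm x) ^+ poly_deg p.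
Proof.
exists (\sum_(m <- msupp p) cmod (mcoeff m p)).
  by apply: sumr_ge0 => m _; exact: cmod_ge0.
move=> x; have ge1 : 1 <= 1 + l1norm x by rewrite lerDl l1norm_ge0.
rewrite /poly_fun mevalE big_distrl /=.
apply: le_trans (cmod_sum _ _ _) _; rewrite big_seq [leRHS]big_seq.
apply: ler_sum => m mp; rewrite cmodM ler_wpM2l ?cmod_ge0//.
apply: le_trans (_ : (1 + l1norm x) ^+ mdeg m <= _).
  by apply: cmod_monomial_le; rewrite lerDr.
rewrite ler_weXn2l// /poly_deg -ltnS prednK; first exact: msize_mdeg_lt.
exact: leq_ltn_trans (msize_mdeg_lt mp).
Qed.

Lemma lipschitz_edist_growth (A : set 'rV[C R]_n)
    (h : 'rV[C R]_n -> 'rV[C R]_n) :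
  lipschitz_wrt (@edist R n) (@edist R n) A h ->
  exists2 c : R, 0 <= c &
    forall x, A x -> 1 + l1norm (h x) <= c * (1 + l1norm x).
Proof.
(* The origin may lie outside [A], so growth is measured from some point [x0] of [A]. The sign of
   [L] is unknown, hence its absolute value below. *)
move=> [L hL]; have [[x0 Ax0]|A0] := pselect (exists x0, A x0); last first.
  by exists 0 => // x Ax; case: A0; exists x.
have H0 := l1norm_ge0 (h x0); have w0 := l1norm_ge0 x0.
have m0 : 0 <= n%:R * `|L| :> R by rewrite mulr_ge0.
exists (1 + l1norm (h x0) + n%:R * `|L| * (1 + l1norm x0)) => [|x Ax].
  by rewrite addr_ge0 ?mulr_ge0 ?addr_ge0.
have u0 := l1norm_ge0 x.
have hx : edist (h x) (h x0) <= `|L| * (l1norm x + l1norm x0).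
  apply: le_trans (hL _ _ Ax Ax0) _.
  apply: le_trans (_ : `|L| * edist x x0 <= _).
    by rewrite ler_wpM2r ?sqrtr_ge0// ler_norm.
  by rewrite ler_wpM2l// edist_le_l1norm.
have := l1norm_le_edist (h x) (h x0).
have : n%:R * edist (h x) (h x0) <= n%:R * `|L| * (l1norm x + l1norm x0).
  by rewrite -mulrA ler_wpM2l.
have := mulr_ge0 m0 (mulr_ge0 u0 w0); have := mulr_ge0 H0 u0.
move: (n%:R * `|L|) m0 (n%:R * edist _ _) => M M0 E; lra.
Qed.

Lemma lipschitz_cdist_growth (h : C R -> C R) :
  lipschitz_wrt (@cdist R) (@cdist R) setT h ->
  exists2 c : R, 0 <= c & forall z, cmod (h z) <= c * (1 + cmod z).
Proof.
move=> [L hL]; exists (cmod (h 0) + `|L|) => [|z].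
  by rewrite addr_ge0 ?cmod_ge0.
have hz := hL z 0 I I; rewrite /cdist subr0 in hz.
apply: le_trans (cmod_le_addB _ (h 0)) _.
have := cmod_ge0 z; have := cmod_ge0 (h 0); have := ler_norm L.
have := normr_ge0 L.
nra.
Qed.

(** * Bounding the degree by the growth *)

(** No limit is taken: if [e < poly_deg p], an explicit point far out on the ray already contradicts
    the bound. *)
Lemma poly_deg_le_growth p (K : set 'rV[C R]_n) (c : R) (e : nat) :
  compact K ->
  (forall x, (~` K) x -> cmod (poly_fun p x) <= c * (1 + l1norm x) ^+ e) ->
  (poly_deg p <= e)%N.
Proof.
move=> /compact_l1norm_bounded[M KM] p_le.
rewrite leqNgt; apply/negP => lt_ed.
(* With the degree written [d.+1], both [e] and the degrees of all lower monomials are at most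
   [d]. *)
have [d dE] : exists d, poly_deg p = d.+1.
  by case: poly_deg lt_ed => // d; exists d.
have p0 : p != 0.
  by apply/eqP => p0; move: lt_ed; rewrite /poly_deg p0 msize0.
have [v] := mpoly_nonroot (pihomog_lead_neq0 p0).
rewrite -cmod_gt0 -/(poly_deg p) dE; set lead := meval v _ => lead0.
pose x : 'rV[C R]_n := \row_i v i.
pose a (m : multinom n) := mcoeff m p * \prod_i x ord0 i ^+ m i.
have leadE : lead = \sum_(m <- msupp p | mdeg m == d.+1) a m.
  rewrite /lead pihomogE raddf_sum /=; apply: eq_bigr => m _.
  by rewrite mevalZ mevalX; congr (_ * _); apply: eq_bigr => i _; rewrite mxE.
(* At the origin all monomials of degree [d.+1] vanish, and [lead] would be 0. *)
have x0 : 0 < l1norm x.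
  rewrite lt_def l1norm_ge0 andbT; apply: contraTneq lead0 => x0.
  rewrite -leNgt leadE; apply: le_trans (cmod_sum _ _ _) _.
  rewrite big1// => m /eqP mE; apply/eqP; rewrite eq_le cmod_ge0 andbT cmodM.
  apply: le_trans (_ : cmod (mcoeff m p) * 0 ^+ mdeg m <= _).
    by rewrite ler_wpM2l ?cmod_ge0// cmod_monomial_le ?x0.
  by rewrite mE expr0n mulr0.
(* [B] gathers what gets multiplied by [t ^+ d]: the assumed bound on [p] and the lower
   monomials. *)
pose B := `|c| * (1 + l1norm x) ^+ e +
  \sum_(m <- msupp p | mdeg m != d.+1) cmod (a m).
have B0 : 0 <= B.
  rewrite addr_ge0 ?mulr_ge0 ?exprn_ge0 ?addr_ge0 ?l1norm_ge0//.
  by apply: sumr_ge0 => m _; exact: cmod_ge0.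
(* The summand 1 gives [1 <= t] and strictness, the second puts [t] times [x] outside [K], and the
   third makes [t * cmod lead] exceed [B]. *)
pose t := 1 + `|M| / l1norm x + B / cmod lead.
have q1 : 0 <= `|M| / l1norm x by rewrite divr_ge0 ?l1norm_ge0.
have q2 : 0 <= B / cmod lead by rewrite divr_ge0 ?cmod_ge0.
have t1 : 1 <= t by rewrite /t -addrA lerDl addr_ge0.
have t0 : 0 <= t by exact: le_trans t1.
pose y := (t%:C : C R) *: x.
have Ky : (~` K) y.
  move=> /KM; rewrite l1normZ// leNgt => /negP; apply.
  apply: le_lt_trans (ler_norm M) _; rewrite -ltr_pdivrMr//.
  by rewrite /t; lra.
have pyE : poly_fun p y = (t%:C : C R) ^+ d.+1 * lead +
    \sum_(m <- msupp p | mdeg m != d.+1) (t%:C : C R) ^+ mdeg m * a m.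
  have -> : poly_fun p y = \sum_(m <- msupp p) (t%:C : C R) ^+ mdeg m * a m.
    rewrite /poly_fun mevalE; apply: eq_bigr => m _.
    rewrite /a mulrCA; congr (_ * _); rewrite mdegE -prodrXr -big_split /=.
    by apply: eq_bigr => i _; rewrite mxE exprMn.
  rewrite (bigID (fun m => mdeg m == d.+1)) /=; congr (_ + _).
  by rewrite leadE big_distrr /=; apply: eq_bigr => m /eqP ->.
have low : cmod (\sum_(m <- msupp p | mdeg m != d.+1)
      (t%:C : C R) ^+ mdeg m * a m)
    <= t ^+ d * \sum_(m <- msupp p | mdeg m != d.+1) cmod (a m).
  apply: le_trans (cmod_sum _ _ _) _; rewrite big_distrr /=.
  rewrite big_seq_cond [leRHS]big_seq_cond; apply: ler_sum => m /andP[mp mE].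
  rewrite cmodM ler_wpM2r ?cmod_ge0// cmodX cmod_real// ler_weXn2l//.
  rewrite -ltnS ltn_neqAle mE -dE /poly_deg -ltnS prednK ?msize_mdeg_lt//.
  exact: leq_ltn_trans (msize_mdeg_lt mp).
have high : cmod (poly_fun p y) <= t ^+ d * (`|c| * (1 + l1norm x) ^+ e).
  apply: le_trans (p_le y Ky) _; rewrite l1normZ//.
  have s0 : 0 <= 1 + l1norm x by rewrite addr_ge0 ?l1norm_ge0.
  have y_le : 1 + t * l1norm x <= t * (1 + l1norm x).
    by rewrite mulrDr mulr1 lerD2r.
  have y0 : 0 <= 1 + t * l1norm x by rewrite addr_ge0 ?mulr_ge0 ?l1norm_ge0.
  apply: le_trans (ler_wpM2r (exprn_ge0 _ y0) (ler_norm c)) _.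
  rewrite mulrCA ler_wpM2l//.
  apply: le_trans (_ : (t * (1 + l1norm x)) ^+ e <= _).
    by rewrite lerXn2r ?nnegrE// mulr_ge0.
  by rewrite exprMn ler_wpM2r ?exprn_ge0// ler_weXn2l// -ltnS -dE.
(* The leading term is the value at [y] minus the lower terms, which [high] and [low] bound. *)
have : t ^+ d * (t * cmod lead) <= t ^+ d * B.
  rewrite mulrA -exprSr mulrDr.
  have -> : t ^+ d.+1 * cmod lead = cmod ((t%:C : C R) ^+ d.+1 * lead).
    by rewrite cmodM cmodX cmod_real.
  apply: le_trans (cmod_le_addB _ (poly_fun p y)) _; rewrite lerD//.
  by rewrite cmodBC pyE addrC addKr.
rewrite ler_pM2l ?exprn_gt0 ?(lt_le_trans ltr01 t1)//.
rewrite -ler_pdivlMr// leNgt => /negP; apply; rewrite /t; lra.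
Qed.

Lemma poly_deg_le (f g : mpoly n (C R)) (K : set 'rV[C R]_n) phi psi :
  compact K ->
  lipschitz_wrt (@edist R n) (@edist R n) (~` K) phi ->
  lipschitz_wrt (@cdist R) (@cdist R) setT psi ->
  (forall x, (~` K) x -> poly_fun f x = psi (poly_fun g (phi x))) ->
  (poly_deg f <= poly_deg g)%N.
Proof.
move=> cK /lipschitz_edist_growth[a a0 phi_le].
move=> /lipschitz_cdist_growth[b b0 psi_le] fE.
have [c c0 g_le] := poly_fun_growth g.
(* The constants compose as [b * (1 + c * (a * w) ^+ poly_deg g)] with [w = 1 + l1norm x]; since
   [1 <= w], the inner 1 is absorbed by the power of [w]. *)
apply: (@poly_deg_le_growth f K (b * (1 + c * a ^+ poly_deg g))) => // x Kx.
rewrite fE//; apply: le_trans (psi_le _) _; rewrite -mulrA ler_wpM2l//.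
rewrite mulrDl mul1r lerD// ?exprn_ege1 ?lerDl ?l1norm_ge0//.
apply: le_trans (g_le _) _; rewrite -mulrA ler_wpM2l// -exprMn.
by rewrite lerXn2r ?nnegrE ?phi_le// ?mulr_ge0 ?addr_ge0 ?l1norm_ge0.
Qed.

End Growth.

Theorem corollary3p15 (R : realType) (n : nat) (f g : mpoly.mpoly n (C R)) :
  bilipschitz_RL_equiv_at_infinity (poly_fun f) (poly_fun g) ->
  poly_deg f = poly_deg g.
Proof.
move=> [K [K' [phi [psi [cK cK' [[_ _ surj] phiL [k [phiK kL]]]]]]]].
move=> [_ psiL [psi' [psiK psi'L]]] fE.
apply/eqP; rewrite eqn_leq (poly_deg_le cK phiL psiL fE) /=.
(* Writing [y = phi x] turns the relation into [g y = psi' (f (k y))] outside [K'], so the roles of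
   [f] and [g] are exchanged. *)
apply: (poly_deg_le cK' kL psi'L) => y K'y.
have [x Kx <-] := surj y K'y.
by rewrite phiK// fE// psiK.
Qed.
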